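(* Let $\nu\ge7$ and $n=2^\nu$. Then the alternating group $\mathrm{Alt}((\mathbb{F}_2)^\nu)$ on the $n$-element set $(\mathbb{F}_2)^\nu$ contains an element $\eta$ of even order with $\mathrm{o}(\eta)>e^{\sqrt{(1/4)\,n\ln n}}$.
   Context: $\mathrm{o}(\eta)$ denotes the order of the permutation $\eta$. *)

(* Defs.v *)
From mathcomp Require Import all_boot all_order all_fingroup all_algebra all_solvable.
From Stdlib Require Import Reals.

(* Main.v *)
(** Let [L m] be the least common multiple of [1, ..., m].  Nair's argument with
    the Leibniz harmonic triangle gives [2 ^ m <= L m] for [7 <= m].  For a set
    of [n >= 128] points put [t = sqrt (n ln n / 4)] and [Y = t / ln 2], and let
    [y > 0] satisfy [ln (L y) <= t < ln (L (y + 1))], so that [y <= Y].  Take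
    disjoint cycles whose lengths are the maximal prime powers [q] dividing
    [L y], one more cycle of length [y + 1], and, if this permutation is odd, a
    transposition of two remaining points.  The order is a multiple of
    [L (y + 1)], hence even and larger than [exp t].  Enough points are
    available: [q / ln q <= Y / ln Y] and [ln n <= 2 ln Y] yield
    [sum q <= Y t / ln Y <= n / (2 ln 2) <= 3 n / 4], and [Y <= n / 6].  Only a
    lower Chebyshev bound is needed. *)

Require Import Defs.
From Stdlib Require Import Reals Lra.
From Coquelicot Require Import Rcomplements(ln_le, ln_div, Rle_div_r, Rlt_div_l).
From mathcomp Require Import all_boot all_order all_fingroup all_algebra all_solvable.
From mathcomp Require Import zify.

Set Implicit Arguments.
Unset Strict Implicit.
Unset Printing Implicit Defensive.

Definition lcm_seq (s : seq nat) : nat := \big[lcmn/1]_(i <- s) i.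

Lemma lcm_seq_nil : lcm_seq [::] = 1.
Proof. by rewrite /lcm_seq big_nil. Qed.

Lemma lcm_seq_cons i s : lcm_seq (i :: s) = lcmn i (lcm_seq s).
Proof. by rewrite /lcm_seq big_cons. Qed.

Lemma dvdn_lcm_seq s m : (lcm_seq s %| m) = all (fun i => i %| m) s.
Proof.
elim: s => [|i s IH]; first by rewrite lcm_seq_nil dvd1n.
by rewrite lcm_seq_cons dvdn_lcm IH.
Qed.

Lemma lcm_seq_gt0 s : (0 < lcm_seq s) = (0 \notin s).
Proof.
elim: s => [|i s IH]; first by rewrite lcm_seq_nil.
by rewrite lcm_seq_cons lcmn_gt0 IH inE negb_or eq_sym lt0n.
Qed.

Lemma dvdn_mem_lcm_seq i s : i \in s -> i %| lcm_seq s.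
Proof. by move: i; apply/allP; rewrite -dvdn_lcm_seq. Qed.

Definition prime_parts (n : nat) : seq nat := [seq n`_p | p : nat <- primes n].

Lemma prod_prime_parts n : 0 < n -> \prod_(q <- prime_parts n) q = n.
Proof.
move=> n_gt0; rewrite [RHS]prod_prime_decomp // prime_decompE !big_map.
by apply: eq_bigr => p _; rewrite p_part.
Qed.

Lemma lcm_seq_prime_parts n : 0 < n -> lcm_seq (prime_parts n) = n.
Proof.
move=> n_gt0; apply/eqP; rewrite eqn_dvd dvdn_lcm_seq all_map.
apply/andP; split; first by apply/allP=> p _ /=; apply: dvdn_part.
by apply/dvdn_partP=> // p p_n; apply/dvdn_mem_lcm_seq/map_f.
Qed.

Lemma prime_parts_gt1 n q : q \in prime_parts n -> 1 < q.
Proof.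
case/mapP=> p p_n ->; have := p_n; rewrite mem_primes => /andP[p_prime _].
by rewrite p_part -(exp1n (logn p n)) ltn_exp2r ?prime_gt1 ?logn_gt0.
Qed.

Definition lcm_upto (n : nat) : nat := lcm_seq (iota 1 n).

Lemma lcm_upto0 : lcm_upto 0 = 1.
Proof. exact: lcm_seq_nil. Qed.

Lemma lcm_uptoS n : lcm_upto n.+1 = lcmn n.+1 (lcm_upto n).
Proof.
by rewrite -addn1 /lcm_upto iotaD cats1 /lcm_seq big_rcons add1n addn1 lcmnC.
Qed.

Lemma lcm_upto_gt0 n : 0 < lcm_upto n.
Proof. by rewrite lcm_seq_gt0 mem_iota. Qed.

Lemma dvdn_lcm_upto i n : 0 < i <= n -> i %| lcm_upto n.
Proof. by move=> i_n; apply: dvdn_mem_lcm_seq; rewrite mem_iota add1n ltnS. Qed.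

Lemma dvdn_lcm_upto2 m n : m <= n -> lcm_upto m %| lcm_upto n.
Proof.
move=> m_n; rewrite dvdn_lcm_seq; apply/allP=> i.
rewrite mem_iota add1n ltnS => /andP[i_gt0 i_m].
by rewrite dvdn_lcm_upto // i_gt0 (leq_trans i_m).
Qed.

Lemma partn_lcm_upto_leq (p n : nat) : 0 < n -> (lcm_upto n)`_p <= n.
Proof.
elim: n => // n IH _; rewrite p_part lcm_uptoS logn_lcm ?lcm_upto_gt0 //.
rewrite /maxn; case: ifP => _; last by rewrite -p_part dvdn_leq ?dvdn_part.
have [->|n_gt0] := posnP n; first by rewrite lcm_upto0 logn1.
by rewrite -p_part (leq_trans (IH n_gt0)).
Qed.

Lemma prime_parts_lcm_upto_leq n q : q \in prime_parts (lcm_upto n) -> q <= n.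
Proof.
case/mapP=> p; case: n => [|n _ ->]; last exact: partn_lcm_upto_leq.
by rewrite lcm_upto0.
Qed.

(* The hypothesis says 1/a = 1/b - 1/c. *)
Lemma dvdn_of_inv_sub a b c M :
  0 < b -> 0 < c -> a * c = b * c + a * b -> b %| M -> c %| M -> a %| M.
Proof.
move=> b_gt0 c_gt0 eq_abc /dvdnP[u M_ub] /dvdnP[v M_vc].
suff M_eq : a * u = M + a * v.
  by rewrite -(dvdn_addl _ (dvdn_mulr v (dvdnn a))) -M_eq dvdn_mulr.
apply/eqP; rewrite -(eqn_pmul2r (_ : 0 < b * c)) ?muln_gt0 ?b_gt0 //; apply/eqP.
have := congr1 (muln M) eq_abc; rewrite mulnDr.
rewrite [in M * (a * c)]M_ub [in M * (a * b)]M_vc; nia.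
Qed.

(* The numbers k * 'C(n, k) are the denominators of the Leibniz harmonic
   triangle. *)
Lemma dvdn_mul_bin_lcm_upto k n : 0 < k <= n -> k * 'C(n, k) %| lcm_upto n.
Proof.
case: k => // k; elim: k n => [|k IH] [|n] // kn.
  by rewrite bin1 mul1n dvdn_lcm_upto ?leqnn.
rewrite /= ltnS in kn.
apply: (dvdn_of_inv_sub (b := k.+1 * 'C(n, k.+1)) (c := k.+1 * 'C(n.+1, k.+1))).
- by rewrite muln_gt0 bin_gt0.
- by rewrite muln_gt0 bin_gt0 (leq_trans kn).
- have /= diag_k := mul_bin_diag n.+1 k.
  rewrite -(mul_bin_diag n.+1 k.+1) -diag_k /=.
  have := congr1 (muln (n.+1 * 'C(n, k.+1))) diag_k.
  by rewrite binS; lia.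
- exact: dvdn_trans (IH _ kn) (dvdn_lcm_upto2 (leqnSn n)).
- exact: IH (leqW kn).
Qed.

Lemma leq_exp4_central_bin m : 4 ^ m <= m.*2.+1 * 'C(m.*2, m).
Proof.
elim: m => [|m IH]; first by rewrite bin0.
have binSE : m.+1 * (m.*2.+3 * 'C(m.*2.+2, m.+1))
             = m.*2.+3 * 2 * (m.*2.+1 * 'C(m.*2, m)).
  have := mul_bin_diag m.*2.+2 m; have := mul_bin_down m.*2.+1 m.
  by rewrite /=; nia.
rewrite doubleS expnS -(leq_pmul2l (ltn0Sn m)) binSE mulnA.
by apply: leq_mul => //; lia.
Qed.

Lemma leq_mul_exp4_lcm_upto m : m * 4 ^ m <= lcm_upto m.*2.+1.
Proof.
have [->|m_gt0] := posnP m; first by [].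
set b := 'C(m.*2, m).
have lcmE : m * (m.*2.+1 * b) = lcmn (m * b) (m.*2.+1 * b).
  have gcd1 : gcdn m m.*2.+1 = 1 by rewrite -addn1 -mul2n gcdnMDl gcdn1.
  by rewrite -muln_lcml mulnA -(muln_lcm_gcd m) gcd1 muln1.
apply: (@leq_trans (m * (m.*2.+1 * b))).
  by rewrite leq_mul2l leq_exp4_central_bin orbT.
rewrite lcmE dvdn_leq ?lcm_upto_gt0 // dvdn_lcm; apply/andP; split.
  apply: dvdn_trans (dvdn_lcm_upto2 (leqnSn _)).
  by apply: dvdn_mul_bin_lcm_upto; lia.
by rewrite (mul_bin_diag m.*2.+1); apply: dvdn_mul_bin_lcm_upto; lia.
Qed.

Lemma leq_exp2_lcm_upto n : 7 <= n -> 2 ^ n <= lcm_upto n.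
Proof.
move=> n7; have [->|n8] := eqVneq n 8.
  apply: leq_trans (_ : 4 * 'C(8, 4) <= _) => //.
  by apply: dvdn_leq (lcm_upto_gt0 _) (dvdn_mul_bin_lcm_upto _).
pose m := n.-1./2; have m3 : 3 <= m by rewrite /m; lia.
apply: (@leq_trans (m * 4 ^ m)).
  have [n_odd|n_even] : n = m.*2.+1 \/ n = m.*2.+2 by rewrite /m; lia.
    by rewrite n_odd expnS -mul2n expnM leq_mul // ltnW.
  by rewrite n_even !expnS -mul2n expnM mulnA leq_mul //; lia.
apply: leq_trans (leq_mul_exp4_lcm_upto m) _.
by apply: dvdn_leq (lcm_upto_gt0 _) (dvdn_lcm_upto2 _); rewrite /m; lia.
Qed.

Section DisjointPermutations.
Import GroupScope.
Variable T : finType.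
Implicit Types (A B : {set T}) (s c : {perm T}).

Lemma perm_onX A s k : perm_on A s -> perm_on A (s ^+ k).
Proof. by have := @groupX _ (perm.Sym_group A) s k; rewrite !inE; apply. Qed.

Lemma disjoint_perm_mul_eq1 A B s c :
    perm_on A s -> perm_on B c -> [disjoint A & B] ->
  (s * c == 1) = (s == 1) && (c == 1).
Proof.
move=> sA cB disAB; apply/eqP/andP=> [sc1|[/eqP-> /eqP->]]; last first.
  by rewrite mul1g.
suff s1 : s = 1 by move: sc1; rewrite s1 mul1g => ->.
apply/permP=> x; rewrite perm1.
have [xA|/(out_perm sA) //] := boolP (x \in A).
have sxB : s x \notin B by rewrite (disjointFr disAB) // perm_closed.
by have /permP/(_ x) := sc1; rewrite permM perm1 (out_perm cB sxB).
Qed.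

Lemma order_disjoint_perm_mul A B s c :
    perm_on A s -> perm_on B c -> [disjoint A & B] ->
  #[s * c] = lcmn #[s] #[c].
Proof.
move=> sA cB disAB.
have dvd_order k : (#[s * c] %| k) = (lcmn #[s] #[c] %| k).
  rewrite dvdn_lcm !order_dvdn expgMn; last exact: perm_onC sA cB disAB.
  exact: disjoint_perm_mul_eq1 (perm_onX k sA) (perm_onX k cB) disAB.
by apply/eqP; rewrite eqn_dvd dvd_order dvdnn -dvd_order dvdnn.
Qed.

Lemma exists_perm_on_order_card A :
  A != set0 -> exists2 c : {perm T}, perm_on A c & #[c] = #|A|.
Proof.
case/set0Pn=> x xA; have uniqA := enum_uniq (mem A).
pose next_in := next (enum A); pose c := perm (can_inj (prev_next uniqA)).
have xE : x \in enum A by rewrite mem_enum.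
have cX k y : (c ^+ k) y = iter k next_in y.
  by rewrite permX; apply: eq_iter => z; rewrite permE.
have orderA : fingraph.order next_in x = #|A|.
  by rewrite (order_cycle (cycle_next uniqA)) // -cardE.
have c_on : perm_on A c.
  apply/subsetP=> y; rewrite inE permE; apply: contraR => yA.
  by rewrite next_nth mem_enum (negbTE yA).
exists c => //; apply/eqP; rewrite eqn_dvd order_dvdn; apply/andP; split.
  apply/eqP/permP=> y; rewrite perm1.
  have [yA|/(out_perm (perm_onX #|A| c_on)) //] := boolP (y \in A).
  by rewrite cX -orderA (iter_order_cycle (cycle_next uniqA)) // mem_enum.
suff -> : #|A| = #|porbit c x| by rewrite porbitE dvdn_orbit.
rewrite -orderA; apply: eq_card => y; apply/idP/porbitP=> [x_y|[k ->]].
  by exists (findex next_in x y); rewrite cX iter_findex.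
by rewrite cX; apply: fconnect_iter.
Qed.

Lemma exists_perm_order_lcm_seq (ls : seq nat) A :
    0%N \notin ls -> (sumn ls <= #|A|)%N ->
  exists2 s : {perm T}, perm_on A s & #[s] = lcm_seq ls.
Proof.
elim: ls A => [|l ls IH] A /=.
  by exists 1; rewrite ?perm_on1 // order1 lcm_seq_nil.
rewrite inE negb_or eq_sym => /andP[l_neq0 ls_neq0] sumA.
have [B BA cardB] : exists2 B : {set T}, B \subset A & #|B| = l.
  have : (0 < 'C(#|A|, l))%N by rewrite bin_gt0 (leq_trans _ sumA) ?leq_addr.
  rewrite -cards_draws => /card_gt0P[B]; rewrite inE => /andP[BA /eqP cardB].
  by exists B.
have [c cB order_c] : exists2 c : {perm T}, perm_on B c & #[c] = #|B|.
  by apply: exists_perm_on_order_card; rewrite -card_gt0 cardB lt0n.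
have [s sAB order_s] :
    exists2 s : {perm T}, perm_on (A :\: B) s & #[s] = lcm_seq ls.
  by apply: IH => //; rewrite cardsD (setIidPr BA) cardB; lia.
have disB : [disjoint B & A :\: B].
  by rewrite disjoint_sym disjoints_subset; apply: subsetDr.
exists (c * s); last first.
  rewrite (order_disjoint_perm_mul cB sAB disB) order_c cardB order_s.
  by rewrite lcm_seq_cons.
apply: perm_onM; first exact: subset_trans cB BA.
exact: subset_trans sAB (subsetDl A B).
Qed.

Lemma exists_Alt_lcm_seq_dvdn_order (ls : seq nat) :
    0%N \notin ls -> (sumn ls + 2 <= #|T|)%N ->
  exists2 s : {perm T}, s \in Alt T & lcm_seq ls %| #[s].
Proof.
move=> ls_neq0 sum_ls.
have /card_gt1P[x [y [_ _ xy]]] : (1 < #|T|)%N by apply: leq_trans sum_ls; lia.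
have sumD : (sumn ls <= #|~: [set x; y]|)%N.
  by have := cardsC [set x; y]; rewrite cards2 xy; lia.
have [s sD order_s] := exists_perm_order_lcm_seq ls_neq0 sumD.
have [odd_s|even_s] := boolP (odd_perm s); last first.
  by exists s; rewrite ?Alt_even // order_s.
have disD : [disjoint ~: [set x; y] & [set x; y]] by rewrite disjoints_subset.
exists (s * tperm x y); first by rewrite Alt_even odd_permM odd_tperm xy odd_s.
by rewrite (order_disjoint_perm_mul sD (tperm_on x y) disD) order_s dvdn_lcml.
Qed.

Lemma exists_Alt_lcm_upto_dvdn_order (y : nat) :
    (sumn (prime_parts (lcm_upto y)) + y + 3 <= #|T|)%N ->
  exists2 s : {perm T}, s \in Alt T & lcm_upto y.+1 %| #[s].
Proof.
move=> sum_y; rewrite lcm_uptoS.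
rewrite -[lcm_upto y]lcm_seq_prime_parts ?lcm_upto_gt0 // -lcm_seq_cons.
apply: exists_Alt_lcm_seq_dvdn_order.
  by rewrite inE /=; apply/negP=> /prime_parts_gt1.
by apply: leq_trans sum_y; rewrite /=; lia.
Qed.

End DisjointPermutations.

Section LogarithmInequalities.
Local Open Scope R_scope.

Lemma ln_le_sub1 x : 0 < x -> ln x <= x - 1.
Proof.
by move=> x_gt0; have := exp_ineq1_le (ln x); rewrite exp_ln //; lra.
Qed.

Lemma ln2_le1 : ln 2 <= 1.
Proof. by have := @ln_le_sub1 2 ltac:(lra); lra. Qed.

Lemma ln2_ge : 2 / 3 <= ln 2.
Proof.
have ln_15_14 : 1 / 15 <= ln (15 / 14).
  by have := @ln_le_sub1 (14 / 15) ltac:(lra); rewrite !ln_div; lra.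
have pow_15_14 : (15 / 14) ^ 10 <= 2 by simpl; lra.
have : INR 10 * ln (15 / 14) <= ln 2.
  by rewrite -ln_pow; [apply: ln_le pow_15_14; apply: pow_lt; lra | lra].
by rewrite /=; lra.
Qed.

Lemma ln2_gt0 : 0 < ln 2.
Proof. by have := ln2_ge; lra. Qed.

Lemma ln_128 : ln 128 = 7 * ln 2.
Proof.
have -> : 128 = 2 ^ 7 by lra.
by rewrite ln_pow; [rewrite INR_IZR_INZ | lra].
Qed.

Lemma mul_ln_le_mul_ln x y : exp 1 <= x -> x <= y -> x * ln y <= y * ln x.
Proof.
move=> ex xy; have x_gt0 := Rlt_le_trans _ _ _ (exp_pos 1) ex.
have lnx_ge1 : 1 <= ln x by rewrite -[1]ln_exp; apply: ln_le ex; apply: exp_pos.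
have : ln (y / x) <= y / x - 1 by apply/ln_le_sub1/Rdiv_lt_0_compat; lra.
rewrite ln_div //; last lra.
move/(Rmult_le_compat_l x _ _ (Rlt_le _ _ x_gt0)).
have -> : x * (y / x - 1) = y - x by field; lra.
by nra.
Qed.

(* At q = 2 < e, where x / ln x does not increase yet, the bound survives
   because 2 / ln 2 = 4 / ln 4. *)
Lemma INR_mul_ln_le_mul_ln (q : nat) Y :
  (1 < q)%N -> INR q <= Y -> 4 <= Y -> INR q * ln Y <= Y * ln (INR q).
Proof.
move=> q_gt1 qY Y4; have e_le3 := exp_le_3.
case: (ltngtP q 2) q_gt1 => // [q_gt2 _|-> _].
  apply: mul_ln_le_mul_ln qY.
  by have := le_INR 3 q (leP q_gt2); rewrite /=; lra.
have ln4 : ln 4 = 2 * ln 2 by rewrite (_ : 4 = 2 * 2) ?ln_mult; lra.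
have := @mul_ln_le_mul_ln 4 Y ltac:(lra) Y4.
by rewrite ln4 [INR 2]INR_IZR_INZ /=; lra.
Qed.

Lemma INR_sumn_mul_ln_le (s : seq nat) Y :
    4 <= Y -> (forall q, q \in s -> (1 < q)%N /\ INR q <= Y) ->
  INR (sumn s) * ln Y <= Y * ln (INR (\prod_(q <- s) q)).
Proof.
move=> Y4; elim: s => [|q s IH] s_bound; first by rewrite big_nil /= ln_1; lra.
have [q_gt1 qY] := s_bound q (mem_head _ _).
have {}s_bound r (rs : r \in s) := s_bound r (mem_behead (s := q :: s) rs).
have prod_gt0 : (0 < \prod_(r <- s) r)%N.
  by rewrite big_seq; apply: prodn_cond_gt0 => r /s_bound[/ltnW].
rewrite big_cons /= plus_INR mult_INR ln_mult; last 2 first.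
- by apply: lt_0_INR; apply/ltP; rewrite ltnW.
- by apply: lt_0_INR; apply/ltP.
by have := IH s_bound; have := INR_mul_ln_le_mul_ln q_gt1 qY Y4; lra.
Qed.

Lemma INR_expn m k : INR (m ^ k)%N = INR m ^ k.
Proof. by elim: k => //= k IH; rewrite expnS mult_INR IH. Qed.

Lemma ln_lcm_upto_ge m : (7 <= m)%N -> INR m * ln 2 <= ln (INR (lcm_upto m)).
Proof.
move=> m7; rewrite -[2]/(INR 2) -ln_pow -?INR_expn; last by rewrite /=; lra.
apply: ln_le; first by apply/lt_0_INR/ltP; rewrite expn_gt0.
exact/le_INR/leP/leq_exp2_lcm_upto.
Qed.

Lemma exists_crossing (u : nat -> R) t m :
  u 0%N <= t < u m -> exists k, u k <= t < u k.+1.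
Proof.
elim: m => [|m IH] [u0 um]; first lra.
by have [/(conj u0)/IH|] := Rlt_le_dec t (u m); last by exists m.
Qed.

Lemma exists_ln_lcm_upto_crossing t : 0 <= t ->
  exists2 y, (0 < y)%N & ln (INR (lcm_upto y)) <= t < ln (INR (lcm_upto y.+1)).
Proof.
move=> t_ge0; have [k kt] := INR_unbounded (t / ln 2).
pose u i := ln (INR (lcm_upto i.+1)).
have [|y] := @exists_crossing u t (k + 7)%N; last by exists y.+1.
split; first by rewrite /u lcm_uptoS lcm_upto0 ln_1.
move/(Rlt_div_l _ _ _ ln2_gt0): kt => kt; apply: Rlt_le_trans kt _.
apply: Rle_trans _ (ln_lcm_upto_ge _); last lia.
apply: Rmult_le_compat_r; first exact/Rlt_le/ln2_gt0.
by apply/le_INR/leP; lia.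
Qed.

End LogarithmInequalities.

Section LandauExponent.
Local Open Scope R_scope.

Definition landau_exponent (x : R) : R := sqrt (/ 4 * (x * ln x)).

Definition max_cycle_length (x : R) : R := landau_exponent x / ln 2.

Lemma landau_exponent_ge0 x : 0 <= landau_exponent x.
Proof. exact: sqrt_pos. Qed.

Lemma landau_exponent_sqr x :
  1 <= x -> landau_exponent x * landau_exponent x = x * ln x / 4.
Proof.
move=> x_ge1; have : 0 <= ln x by rewrite -ln_1; apply: ln_le; lra.
by rewrite /landau_exponent => ?; rewrite sqrt_sqrt; [field | nra].
Qed.

Lemma max_cycle_length_mul_ln2 x :
  max_cycle_length x * ln 2 = landau_exponent x.
Proof. by rewrite /max_cycle_length; field; have := ln2_gt0; lra. Qed.

Lemma max_cycle_length_ge0 x : 0 <= max_cycle_length x.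
Proof.
apply: Rmult_le_pos; first exact: landau_exponent_ge0.
exact/Rlt_le/Rinv_0_lt_compat/ln2_gt0.
Qed.

Variable x : R.
Hypothesis x_ge128 : 128 <= x.
Let t := landau_exponent x.
Let Y := max_cycle_length x.

Lemma ln_ge_7ln2 : 7 * ln 2 <= ln x.
Proof. by rewrite -ln_128; apply: ln_le; lra. Qed.

Lemma max_cycle_length_mul_ln2_sqr : (Y * ln 2) * (Y * ln 2) = x * ln x / 4.
Proof. by rewrite max_cycle_length_mul_ln2 landau_exponent_sqr //; lra. Qed.

Lemma le_max_cycle_length_sqr : x <= Y * Y.
Proof.
have := ln_ge_7ln2; have := ln2_ge; have := ln2_le1 => ln2_le ln2_ge lnx_ge.
have YYln2_ge : 7 / 4 * x <= Y * Y * ln 2.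
  by apply: (Rmult_le_reg_r (ln 2)); have := max_cycle_length_mul_ln2_sqr; nra.
by nra.
Qed.

Lemma max_cycle_length_ge11 : 11 <= Y.
Proof.
have := max_cycle_length_ge0 x; have := le_max_cycle_length_sqr.
by rewrite -/Y; nra.
Qed.

Lemma max_cycle_length_le : Y <= x / 6.
Proof.
have ln2_ge := ln2_ge.
have lnx_le : 128 * ln x <= x * (7 * ln 2).
  by rewrite -ln_128; apply: mul_ln_le_mul_ln => //; have := exp_le_3; lra.
have YYln2_le : Y * Y * ln 2 <= 7 / 512 * (x * x).
  by apply: (Rmult_le_reg_r (ln 2)); have := max_cycle_length_mul_ln2_sqr; nra.
have YY_le : Y * Y <= 21 / 1024 * (x * x) by nra.
by nra.
Qed.

Lemma mul_ln_max_cycle_length_le S : S * ln Y <= Y * t -> S <= 3 / 4 * x.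
Proof.
move=> S_le; have ln2_ge := ln2_ge; have Y_ge11 := max_cycle_length_ge11.
have lnx_gt0 : 0 < ln x by have := ln_ge_7ln2; lra.
have lnx_le : ln x <= 2 * ln Y.
  have -> : 2 * ln Y = ln (Y * Y) by rewrite ln_mult; lra.
  by apply: ln_le le_max_cycle_length_sqr; lra.
have tt_eq : t * t = Y * t * ln 2.
  by rewrite -{1}[t]max_cycle_length_mul_ln2 -/Y; ring.
have Yt_ge0 : 0 <= Y * t.
  exact: Rmult_le_pos (max_cycle_length_ge0 x) (landau_exponent_ge0 x).
have Yt_le : 2 / 3 * (Y * t) <= x * (2 * ln Y) / 4.
  by have := @landau_exponent_sqr x ltac:(lra); rewrite -/t; nra.
by apply: (Rmult_le_reg_r (ln Y)); lra.
Qed.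

End LandauExponent.

Section AlternatingGroup.
Local Open Scope R_scope.

Lemma INR_le_max_cycle_length x y :
    128 <= x -> ln (INR (lcm_upto y)) <= landau_exponent x ->
  INR y <= max_cycle_length x.
Proof.
move=> x128 y_le; have [y7|y_lt7] := leqP 7 y.
  apply/(Rle_div_r _ _ _ ln2_gt0).
  exact: Rle_trans (ln_lcm_upto_ge y7) y_le.
have := max_cycle_length_ge11 x128; have := le_INR _ _ (leP (ltnW y_lt7)).
by rewrite [INR 7]INR_IZR_INZ /=; lra.
Qed.

Lemma sumn_prime_parts_lcm_upto_leq (n y : nat) :
    (128 <= n)%N -> ln (INR (lcm_upto y)) <= landau_exponent (INR n) ->
  (sumn (prime_parts (lcm_upto y)) + y + 3 <= n)%N.
Proof.
move=> n_ge128 y_le; set s := prime_parts _.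
have n128 : 128 <= INR n.
  by have := le_INR _ _ (leP n_ge128); rewrite [INR 128]INR_IZR_INZ.
have Y_ge := max_cycle_length_ge11 n128; have Y_le := max_cycle_length_le n128.
have y_leY := INR_le_max_cycle_length n128 y_le.
have s_bound q : q \in s -> (1 < q)%N /\ INR q <= max_cycle_length (INR n).
  move=> qs; split; first exact: prime_parts_gt1 qs.
  by apply: Rle_trans y_leY; apply/le_INR/leP/prime_parts_lcm_upto_leq.
have sum_le : INR (sumn s) <= 3 / 4 * INR n.
  apply: mul_ln_max_cycle_length_le => //.
  apply: Rle_trans (INR_sumn_mul_ln_le _ s_bound) _; first lra.
  rewrite prod_prime_parts ?lcm_upto_gt0 //.
  by apply: Rmult_le_compat_l y_le; lra.
by apply/leP/INR_le; rewrite !plus_INR [INR 3]INR_IZR_INZ /=; lra.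
Qed.

Theorem exists_Alt_even_order_gt (T : finType) : (128 <= #|T|)%N ->
  exists eta : {perm T},
    [/\ eta \in Alt T, ~~ odd #[eta]%g &
      exp (landau_exponent (INR #|T|)) < INR #[eta]%g].
Proof.
move=> T128.
have [y y_gt0 [y_le y_gt]] :=
  exists_ln_lcm_upto_crossing (landau_exponent_ge0 (INR #|T|)).
have sum_y := sumn_prime_parts_lcm_upto_leq T128 y_le.
have [eta eta_Alt L_dvd] := exists_Alt_lcm_upto_dvdn_order sum_y.
exists eta; split=> //.
  by rewrite -dvdn2; apply: dvdn_trans L_dvd; apply: dvdn_lcm_upto.
apply: Rlt_le_trans (_ : INR (lcm_upto y.+1) <= _); last first.
  by apply/le_INR/leP/(dvdn_leq _ L_dvd).
rewrite -[INR (lcm_upto _)]exp_ln; first exact: exp_increasing.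
exact/lt_0_INR/ltP/lcm_upto_gt0.
Qed.

End AlternatingGroup.

Theorem mainTheorem13 (nu : nat) (n : nat) :
  (7 <= nu)%N -> n = expn 2 nu ->
  exists eta : {perm 'rV['F_2]_nu},
    [/\ eta \in Alt ('rV['F_2]_nu), ~~ odd #[eta]%g &
      (Rlt (exp (sqrt (Rmult (Rinv (INR 4)) (Rmult (INR n) (ln (INR n)))))) (INR #[eta]%g))].
Proof.
move=> nu7 ->.
have card_rV : #|{: 'rV['F_2]_nu}| = 2 ^ nu by rewrite card_mx card_Fp // mul1n.
have := @exists_Alt_even_order_gt 'rV['F_2]_nu.
rewrite card_rV [INR 4]INR_IZR_INZ; apply.
by rewrite -[128]/(2 ^ 7) leq_exp2l.
Qed.
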